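(* Let $N$ be an even positive integer, let $A(0),\dots,A(N/2-1)$ be complex numbers, and put $X(u)=|A(u)|^2\ge 0$. Let $T$ be either of the two index sets $\{1,2,\dots,N\}$ or $\{0,1,\dots,N-1\}$, and let $$J(\tau)=2\sum_{u=0}^{N/2-1}|A(u)|^2\Bigl(1+\cos\bigl(\tfrac{2\pi}{N}\tau u\bigr)\Bigr),\qquad \tau\in T.$$ Then $$|A(u)|^2=\begin{cases}\dfrac1N\displaystyle\sum_{\tau\in T}J(\tau)\cos\bigl(\tfrac{2\pi}{N}\tau u\bigr), & u=1,\dots,N/2-1,\\[2mm] \dfrac1{4N}\displaystyle\sum_{\tau\in T}J(\tau)-\dfrac12\sum_{u_1=1}^{N/2-1}|A(u_1)|^2, & u=0.\end{cases}$$ Moreover, for both choices of $T$, let $$a(u)=\bigl|\mathrm{IFFT}(J)(u)\bigr|,\qquad u=1,\dots,N,$$ where $\mathrm{IFFT}$ is applied to the sequence $(J(\tau))_{\tau\in T}$ listed in increasing order of $\tau$. Then $$|A(u)|^2=\begin{cases}a(u+1), & u=1,\dots,N/2-1,\\[1mm] \dfrac1{4N}\displaystyle\sum_{\tau\in T}J(\tau)-\dfrac12\sum_{u_1=1}^{N/2-1}|A(u_1)|^2, & u=0.\end{cases}$$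
   Context: For a sequence $y=(y_1,\dots,y_N)$ of complex numbers, the inverse FFT (MATLAB convention) is the sequence indexed by $u=1,\dots,N$ given by $$\mathrm{IFFT}(y)(u)=\frac1N\sum_{k=1}^{N}y_k\exp\bigl(j\tfrac{2\pi}{N}(k-1)(u-1)\bigr),$$ where $j$ is the imaginary unit. *)

(* Defs.v *)
From HB Require Import structures.
From mathcomp Require Export all_boot all_order all_algebra.
From mathcomp Require Export complex.
From mathcomp Require Export reals sequences exp trigo.

Set Implicit Arguments.
Unset Strict Implicit.
Unset Printing Implicit Defensive.

Export Order.TTheory GRing.Theory Num.Theory.

Local Open Scope ring_scope.
Local Open Scope complex_scope.

(* The R-valued modulus: the library's norm `|z| on R[i] is itself a (real)
   element of R[i]. *)
Definition cmod (R : realType) (z : R[i]) : R := Normc.normc z.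

Lemma cmodE (R : realType) (z : R[i]) : (cmod z)%:C = `|z|.
Proof. by []. Qed.

(* The complex exponential, in Cartesian form: the library only has expR. *)
Definition cexp (R : realType) (z : R[i]) : R[i] :=
  (expR (complex.Re z))%:C * (cos (complex.Im z) +i* sin (complex.Im z)).

Lemma cexpD (R : realType) (z w : R[i]) : cexp (z + w) = cexp z * cexp w.
Proof.
case: z w => [a b] [c d]; rewrite /cexp /= expRD cosD sinD rmorphM /= mulrACA.
by congr (_ * _); apply/eqP; rewrite eq_complex /= [sin b * cos d + _]addrC !eqxx.
Qed.

(* The index u is 1-based and meaningful for 1 <= u <= size y; the entry y_k is
   the 0-based y`_k.-1. *)
Definition IFFT (R : realType) (y : seq R[i]) (u : nat) : R[i] :=
  let N := size y in
  (N%:R)^-1 * \sum_(1 <= k < N.+1)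
    y`_k.-1 * cexp ('i%C * (2 * pi / N%:R * (k%:R - 1) * (u%:R - 1))%:C).

(* Only the values A 0, ..., A (N./2).-1 are used. *)
Definition J (R : realType) (N : nat) (A : nat -> R[i]) (tau : nat) : R :=
  2 * \sum_(0 <= u < N./2)
    cmod (A u) ^+ 2 * (1 + cos (2 * pi / N%:R * tau%:R * u%:R)).

(* Main.v *)
Require Import Defs.
From mathcomp Require Import zify ring lra.

Set Implicit Arguments.
Unset Strict Implicit.
Unset Printing Implicit Defensive.

(** Put w = exp (2 pi i / N) and X v = |A v|^2.  Writing the cosine as the half
    sum of two conjugate powers of w turns J into a trigonometric polynomial:
    J tau is the sum over v < N/2 of X v (2 + w^(v tau) + w^((N - v) tau)),
    where N - v stands for the frequency - v ([J_powers]).  As w is a primitive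
    N-th root of unity ([unity_root_prim]), the powers w^(k tau) sum to N or to
    0 over any N consecutive tau, according to whether N divides k
    ([sum_prim_root]).  Because all v and u are below N/2, the frequency u + v
    vanishes modulo N only for u = v = 0 and u - v only for u = v.  Hence, for
    u < N/2, the sum of J tau w^(u tau) picks out N X u, plus a contribution of
    the constant term when u = 0 ([sum_J_powers]).

    All the claims are readings of this one identity.  For 0 < u its real part
    is the cosine formula; at u = 0 it gives X 0 up to the sum of the other X v.
    The IFFT of the values of J on a window starting at c is 1/N times the same
    sum up to a power of the unimodular number w, since its phases start from 0
    instead of c; taking the modulus removes that power ([cmod_IFFT_J]).  The
    two index sets are the windows starting at 1 and at 0. *)

Local Open Scope ring_scope.
Local Open Scope complex_scope.

(** * Orthogonality of the powers of a root of unity *)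

(** When w^k differs from 1 the geometric sum vanishes, because w^k - 1 times it
    is w^(kN) - 1 = 0; the starting point of the window only contributes a
    factor. *)
Lemma sum_prim_root (F : idomainType) (N : nat) (w : F) (c k : nat) :
  N.-primitive_root w ->
  \sum_(tau <- iota c N) w ^+ (k * tau) = (N %| k)%N%:R * N%:R.
Proof.
move=> w_prim; rewrite (prim_order_dvd w_prim).
have -> : \sum_(tau <- iota c N) w ^+ (k * tau)
          = (w ^+ k) ^+ c * \sum_(i < N) (w ^+ k) ^+ i.
  rewrite -[c in iota c]addn0 iotaDl big_map big_distrr /=.
  rewrite -[N in iota 0 N]subn0 -/(index_iota 0 N) big_mkord.
  by apply: eq_bigr => i _; rewrite exprM exprD.
have [->|wk_neq1] := eqVneq (w ^+ k) 1.
  rewrite expr1n !mul1r (eq_bigr (fun=> 1)) => [|i _]; last exact: expr1n.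
  by rewrite sumr_const card_ord.
rewrite mul0r; have /eqP := subrX1 (w ^+ k) N.
rewrite (exprAC _ k N) (prim_expr_order w_prim) expr1n subrr eq_sym.
by rewrite mulf_eq0 subr_eq0 (negPf wk_neq1) /= => /eqP ->; rewrite mulr0.
Qed.

(** * The root of unity exp (2 pi i / N) *)

Definition expi (R : realType) (t : R) : R[i] := cos t +i* sin t.

Definition unity_root (R : realType) (N : nat) : R[i] := expi (2 * pi / N%:R).

Section Expi.
Variable R : realType.
Implicit Types t s : R.

Lemma cexp_imaginary t : cexp ('i * t%:C) = expi t.
Proof.
rewrite /cexp /= !(mul0r, mul1r, mulr0, add0r, oppr0) expR0.
exact: mul1r.
Qed.

Lemma expi0 : expi 0 = 1 :> R[i].
Proof. by rewrite /expi cos0 sin0. Qed.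

Lemma expiD t s : expi (t + s) = expi t * expi s.
Proof. by rewrite -!cexp_imaginary rmorphD mulrDr cexpD. Qed.

Lemma expiX t n : expi t ^+ n = expi (t * n%:R).
Proof.
elim: n => [|n IHn]; first by rewrite mulr0 expi0.
by rewrite exprS IHn -expiD -natr1 mulrDr mulr1 addrC.
Qed.

Lemma cmod_expi t : cmod (expi t) = 1.
Proof. by rewrite /cmod /expi /= cos2Dsin2 sqrtr1. Qed.

Lemma expiDN t : expi t + expi (- t) = (2 * cos t)%:C.
Proof.
rewrite /expi cosN sinN; apply/eqP; rewrite eq_complex /= subrr eqxx andbT.
by rewrite mulr_natl mulr2n.
Qed.

(** The half-angle formula 1 - cos t = 2 sin^2 (t/2) reduces this to the
    positivity of sin on the open interval (0, pi). *)
Lemma expi_neq1 t : 0 < t -> t < 2 * pi -> expi t != 1.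
Proof.
move=> t_gt0 t_lt; rewrite eq_complex negb_and /=; apply/orP; left.
have sin_gt0 : 0 < sin (t / 2).
  by apply: sin_gt0_pi; rewrite ?divr_gt0 //= ltr_pdivrMr // mulrC.
have -> : t = (t / 2) *+ 2 by rewrite -mulr_natr divfK // pnatr_eq0.
rewrite cos_mulr2n cos2sin2 lt_eqF //.
have := exprn_gt0 2 sin_gt0; set s := sin _ ^+ 2; lra.
Qed.

End Expi.

Section UnityRoot.
Variables (R : realType) (N : nat).
Hypothesis N_gt0 : (0 < N)%N.
Notation w := (unity_root R N).

Let N_neq0 : N%:R != 0 :> R.
Proof. by rewrite pnatr_eq0 -lt0n. Qed.

Lemma unity_rootX n : w ^+ n = expi (2 * pi / N%:R * n%:R).
Proof. exact: expiX. Qed.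

(** The order m of w divides N; if it were smaller, w^m would have an angle
    strictly between 0 and 2 pi and so could not be 1. *)
Lemma unity_root_prim : N.-primitive_root w.
Proof.
have wN : w ^+ N = 1.
  rewrite unity_rootX divfK // mulr_natl mulr2n expiD /expi cospi sinpi.
  by apply/eqP; rewrite eq_complex /=; apply/andP; split; apply/eqP; ring.
have [m w_prim m_dvdN] := prim_order_exists N_gt0 wN.
have [mN|m_neqN] := eqVneq m N; first by rewrite mN in w_prim.
have m_ltN : (m < N)%N by rewrite ltn_neqAle m_neqN dvdn_leq.
have m_gt0 := prim_order_gt0 w_prim.
have: w ^+ m != 1.
  have pi_gt0 := pi_gt0 R.
  rewrite unity_rootX expi_neq1 //.
    by rewrite mulr_gt0 ?divr_gt0 ?ltr0n ?mulr_gt0.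
  rewrite mulrAC ltr_pdivrMr ?ltr0n // ltr_pM2l ?mulr_gt0 //.
  by rewrite ltr_nat.
by rewrite (prim_expr_order w_prim) eqxx.
Qed.

(** The exponent N - v plays the role of the negative frequency - v, which keeps
    all the exponents natural numbers. *)
Lemma unity_root_cos v tau : (v <= N)%N ->
  w ^+ (v * tau) + w ^+ ((N - v) * tau)
  = (2 * cos (2 * pi / N%:R * tau%:R * v%:R))%:C.
Proof.
move=> v_leN; have -> : w ^+ ((N - v) * tau)
    = expi (- (2 * pi / N%:R * tau%:R * v%:R)).
  have wE : w ^+ (v * tau) = expi (2 * pi / N%:R * tau%:R * v%:R).
    by rewrite unity_rootX natrM [v%:R * _]mulrC mulrA.
  have inv : w ^+ ((N - v) * tau) * w ^+ (v * tau) = 1.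
    rewrite -exprD -mulnDl subnK // exprM (prim_expr_order unity_root_prim).
    exact: expr1n.
  rewrite -[LHS]mulr1 -(expi0 R) -(subrr (2 * pi / N%:R * tau%:R * v%:R)).
  by rewrite expiD -wE mulrA inv mul1r.
rewrite -expiDN; congr (_ + _).
by rewrite unity_rootX natrM [v%:R * _]mulrC mulrA.
Qed.

End UnityRoot.

(** * Fourier coefficients of J *)

Section Coefficients.
Variables (R : realType) (N : nat) (A : nat -> R[i]).
Hypothesis N_gt0 : (0 < N)%N.
Notation w := (unity_root R N).
Notation X v := (cmod (A v) ^+ 2).

Lemma J_powers tau :
  (J N A tau)%:C =
  \sum_(0 <= v < N./2)
    (X v)%:C * (2 + (w ^+ (v * tau) + w ^+ ((N - v) * tau))).
Proof.
rewrite /J big_distrr rmorph_sum /=; apply: eq_big_nat => v /andP[_ v_lt].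
rewrite unity_root_cos //; last by lia.
have -> : (2 : R[i]) = (2 : R)%:C by rewrite rmorph_nat.
by rewrite -rmorphD -rmorphM; congr (_%:C); rewrite mulrCA mulrDr mulr1.
Qed.

(** Exchanging the two sums leaves, for each v, the power sums at the three
    frequencies u, u + v and u - v (encoded as u + (N - v)); the bound N/2 on
    both u and v is what prevents u + v from being a nonzero multiple of N. *)
Lemma sum_J_powers c u : (u < N./2)%N ->
  \sum_(tau <- iota c N) (J N A tau)%:C * w ^+ (u * tau) =
  (N%:R * (X u + (u == 0%N)%:R * (X 0%N + 2 * \sum_(0 <= v < N./2) X v)))%:C.
Proof.
move=> u_lt; have w_prim := unity_root_prim R N_gt0.
under eq_bigr do rewrite J_powers big_distrl /=.
rewrite exchange_big /=.
transitivity (\sum_(0 <= v < N./2)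
    (N%:R * (X v * (v == u)%:R
             + (u == 0%N)%:R * (X v * (v == 0%N)%:R + 2 * X v)))%:C).
  apply: eq_big_nat => v /andP[_ v_lt].
  have -> : \sum_(tau <- iota c N) (X v)%:C
        * (2 + (w ^+ (v * tau) + w ^+ ((N - v) * tau))) * w ^+ (u * tau)
      = (X v)%:C * (2 * \sum_(tau <- iota c N) w ^+ (u * tau)
          + \sum_(tau <- iota c N) w ^+ ((u + v) * tau)
          + \sum_(tau <- iota c N) w ^+ ((u + (N - v)) * tau)).
    rewrite !big_distrr -!big_split /= big_distrr.
    by apply: eq_bigr => tau _; rewrite !mulnDl !exprD /=; ring.
  rewrite !(sum_prim_root _ _ w_prim).
  have -> : (N %| u)%N = (u == 0%N).
    apply/idP/eqP => [/dvdnP[q uE]|->]; last exact: dvdn0.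
    by case: q uE => [|q]; nia.
  have -> : (N %| u + v)%N = (u == 0%N) && (v == 0%N).
    apply/idP/andP => [/dvdnP[q uE]|[/eqP-> /eqP->]]; last exact: dvdn0.
    by case: q uE => [|q]; nia.
  have -> : (N %| u + (N - v))%N = (v == u).
    apply/idP/eqP => [/dvdnP[q uE]|->]; last by rewrite subnKC //; lia.
    by case: q uE => [|[|q]]; nia.
  rewrite !(rmorphM, rmorphD, rmorph_nat) /= -mulnb natrM.
  ring.
have pick j : (j < N./2)%N -> \sum_(0 <= v < N./2) X v * (v == j)%:R = X j.
  move=> j_lt; rewrite big_mkord (bigD1 (Ordinal j_lt)) //= eqxx mulr1.
  rewrite big1 ?addr0 // => v; rewrite -val_eqE /= => /negPf ->.
  by rewrite mulr0.
rewrite -rmorph_sum; congr (_%:C); rewrite -big_distrr big_split /=.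
congr (_ * _).
by rewrite -big_distrr big_split -big_distrr /= !pick //; case: (u) u_lt; lia.
Qed.

Lemma sum_J_cos c u : (1 <= u < N./2)%N ->
  \sum_(tau <- iota c N) J N A tau * cos (2 * pi / N%:R * tau%:R * u%:R)
  = N%:R * X u.
Proof.
move=> /andP[u_gt0 u_lt].
have := congr1 (@complex.Re R) (sum_J_powers c u_lt).
rewrite (negPf (lt0n_neq0 u_gt0)) mul0r addr0 /= => <-.
rewrite raddf_sum; apply: eq_bigr => tau _.
by rewrite unity_rootX natrM [u%:R * _]mulrC mulrA /= mul0r subr0.
Qed.

Lemma sum_J c : (0 < N./2)%N ->
  \sum_(tau <- iota c N) J N A tau
  = N%:R * (4 * X 0%N + 2 * \sum_(1 <= v < N./2) X v).
Proof.
move=> half_gt0; apply: (@complexI R).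
have := sum_J_powers c half_gt0; under eq_bigr do rewrite mul0n mulr1.
rewrite -rmorph_sum => ->; congr (_%:C).
by rewrite mul1r [in LHS]big_ltn //; ring.
Qed.

(** The phases of the IFFT are the powers w^(u k) with k counted from the start
    c of the window, so multiplying by w^(u c) aligns them with tau = c + k. *)
Lemma IFFT_J c u :
  w ^+ (u * c) * IFFT [seq (J N A tau)%:C | tau <- iota c N] u.+1
  = N%:R^-1 * \sum_(tau <- iota c N) (J N A tau)%:C * w ^+ (u * tau).
Proof.
rewrite /IFFT size_map size_iota mulrCA; congr (_ * _).
rewrite big_add1 big_distrr /= big_mkord.
rewrite -[c in RHS]addn0 iotaDl big_map.
rewrite -[N in iota 0 N]subn0 -/(index_iota 0 N) big_mkord.
apply: eq_bigr => k _.
rewrite (nth_map 0%N) ?size_iota // nth_iota // cexp_imaginary.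
rewrite -[k.+1%:R]natr1 -[u.+1%:R]natr1 !addrK mulnDr exprD.
rewrite [w ^+ (u * k)]unity_rootX natrM.
by rewrite [u%:R * _]mulrC !mulrA [_%:C * _]mulrC.
Qed.

Lemma cmod_IFFT_J c u : (1 <= u < N./2)%N ->
  cmod (IFFT [seq (J N A tau)%:C | tau <- iota c N] u.+1) = X u.
Proof.
move=> /andP[u_gt0 u_lt]; have := IFFT_J c u; rewrite sum_J_powers //.
rewrite (negPf (lt0n_neq0 u_gt0)) mul0r addr0 rmorphM rmorph_nat /= mulKf; last first.
  by rewrite pnatr_eq0 -lt0n.
move=> /(congr1 Num.norm); rewrite normrM unity_rootX -[`|expi _|]cmodE.
rewrite cmod_expi mul1r -[`|IFFT _ _|]cmodE ger0_norm ?lecR ?sqr_ge0 //.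
exact: (@complexI R).
Qed.

End Coefficients.

Theorem proposition3 (R : realType) (N : nat) (A : nat -> R[i]) (T : seq nat)
    (N_gt0 : (0 < N)%N) (N_even : ~~ odd N)
    (HT : T = iota 1 N \/ T = iota 0 N) :
  let a (u : nat) : R := cmod (IFFT [seq (J N A tau)%:C | tau <- T] u) in
  ((forall u : nat, (1 <= u < N./2)%N ->
      cmod (A u) ^+ 2 =
        (N%:R)^-1 * \sum_(tau <- T) J N A tau * cos (2 * pi / N%:R * tau%:R * u%:R))
   /\
   cmod (A 0%N) ^+ 2 =
     (4 * N%:R)^-1 * (\sum_(tau <- T) J N A tau)
     - 2^-1 * \sum_(1 <= u1 < N./2) cmod (A u1) ^+ 2)
  /\
  ((forall u : nat, (1 <= u < N./2)%N -> cmod (A u) ^+ 2 = a u.+1)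
   /\
   cmod (A 0%N) ^+ 2 =
     (4 * N%:R)^-1 * (\sum_(tau <- T) J N A tau)
     - 2^-1 * \sum_(1 <= u1 < N./2) cmod (A u1) ^+ 2).
Proof.
have [c ->] : exists c, T = iota c N by case: HT => ->; [exists 1%N | exists 0%N].
have N_neq0 : N%:R != 0 :> R by rewrite pnatr_eq0 -lt0n.
have half_gt0 : (0 < N./2)%N by lia.
move=> a.
have at0 : cmod (A 0%N) ^+ 2 =
     (4 * N%:R)^-1 * (\sum_(tau <- iota c N) J N A tau)
     - 2^-1 * \sum_(1 <= u1 < N./2) cmod (A u1) ^+ 2.
  by rewrite sum_J //; field.
split; split => // u u_bounds; first by rewrite sum_J_cos // mulKf.
by rewrite /a cmod_IFFT_J.
Qed.
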